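(* Let $X$ be a real Banach space with $\dim X\ge 3$. Suppose that $X$ contains a closed subspace of codimension $1$ which is the range of a linear projection $P:X\to X$ with $\|P\|=1$, and suppose that the group of surjective linear isometries of $X$ is almost transitive. Then $X$ is isometric to a Hilbert space.
   Context: The group of surjective linear isometries of $X$ is called almost transitive if for every $x$ in the unit sphere $S_X=\{x\in X:\|x\|=1\}$, the orbit $G_x=\{Tx: T:X\to X \text{ a surjective linear isometry}\}$ is dense in $S_X$. *)

(* Defs.v *)
From HB Require Import structures.
From mathcomp Require Import all_boot all_order all_algebra.
From mathcomp Require Import all_classical all_reals topology normedtype.
Set Implicit Arguments. Unset Strict Implicit. Unset Printing Implicit Defensive.
Import Order.TTheory GRing.Theory Num.Theory.
Import numFieldNormedType.Exports.
Local Open Scope classical_set_scope.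
Local Open Scope ring_scope.

(* operator norm: sup of |f x| over the closed unit ball
   (MathComp's sup is 0 for sets without a supremum, so opnorm f = 1
   forces f to be bounded with norm exactly 1) *)
Definition opnorm (R : realType) (X : normedModType R) (f : X -> X) : R :=
  sup [set `|f x| | x in [set x : X | `|x| <= 1]].

Definition dim_ge3 (R : realType) (X : normedModType R) : Prop :=
  exists x1 x2 x3 : X, forall a b c : R,
    a *: x1 + b *: x2 + c *: x3 = 0 -> [/\ a = 0, b = 0 & c = 0].

(* M is a closed subspace of codimension 1 (given that M is a subspace) *)
Definition closed_codim1 (R : realType) (X : normedModType R) (M : set X) : Prop :=
  closed M /\ exists v : X, ~ M v /\
    forall x : X, exists (m : X) (t : R), M m /\ x = m + t *: v.

Definition is_surj_lin_isometry (R : realType) (X Y : normedModType R)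
    (T : {linear X -> Y}) : Prop :=
  (forall x, `|T x| = `|x|) /\ forall y : Y, exists x : X, T x = y.

Definition almost_transitive (R : realType) (X : normedModType R) : Prop :=
  forall x y : X, `|x| = 1 -> `|y| = 1 -> forall e : R, 0 < e ->
    exists T : {linear X -> X}, is_surj_lin_isometry T /\ `|T x - y| < e.

Definition inner_product_for_norm (R : realType) (H : normedModType R)
    (ip : H -> H -> R) : Prop :=
  [/\ forall x y, ip x y = ip y x,
      forall a x y z, ip (a *: x + y) z = a * ip x z + ip y z,
      forall x, 0 <= ip x x,
      forall x, ip x x = 0 -> x = 0
    & forall x, ip x x = `|x| ^+ 2].

Definition isometric_to_Hilbert (R : realType) (X : normedModType R) : Prop :=
  exists (H : completeNormedModType R) (ip : H -> H -> R) (T : {linear X -> H}),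
    inner_product_for_norm ip /\ is_surj_lin_isometry T.

(* Main.v *)
Require Import Defs.
From HB Require Import structures.
From mathcomp Require Import all_boot all_order all_algebra.
From mathcomp Require Import all_classical all_reals topology normedtype.
From mathcomp Require Import interval_inference sequences derive ring lra.
Import Order.TTheory GRing.Theory Num.Theory.
Import numFieldNormedType.Exports.
Local Open Scope classical_set_scope.
Local Open Scope ring_scope.
Set Implicit Arguments. Unset Strict Implicit. Unset Printing Implicit Defensive.

(** Almost transitivity moves the kernel of the given projection close to any
    line of [X], and by compactness every vector [v] of a three-dimensional
    subspace [E] spans the kernel of a projection [x - g x *: v] of norm at most
    one onto a plane of [E].  The sign of [g x] is that of the derivative of the
    norm at [x] along [v]; as [g] is linear, a functional supporting [x1 + x2]
    vanishes on the common kernel of functionals supporting [x1] and [x2], as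
    soon as [x1] is a smooth point.  Smooth points are dense in [E], and if some
    [x] had two support functionals, then those of all smooth points would lie
    in their span, which is impossible in dimension three.  So the norm of [E]
    is smooth.

    For [m] in the kernel of the functional supporting [a], the norm of
    [m + t *: a] then depends on [m] only through its norm, so that the
    reflection along [a] is an isometry.  A product of two reflections with the
    same hyperplane is a shear, hence the norm is strictly convex, and the
    reflection along [x - y] exchanges [x] and [y] when they have equal norms.
    In a plane, these exchanges produce an isometry with determinant one and
    trace greater than two unless the norm is Euclidean. *)

(** * The Euclidean pairing on row vectors, and compactness *)

Definition dot (R : realType) (n : nat) (u v : 'rV[R]_n) : R :=
  \sum_(i < n) u 0 i * v 0 i.

Section Dot.
Variables (R : realType) (n : nat).
Implicit Types u v w : 'rV[R]_n.

Lemma dotC u v : dot u v = dot v u.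
Proof. by apply: eq_bigr => i _; rewrite mulrC. Qed.

Lemma dotDr u v w : dot u (v + w) = dot u v + dot u w.
Proof.
by rewrite /dot -big_split; apply: eq_bigr => i _; rewrite mxE mulrDr.
Qed.

Lemma dotZr (a : R) u v : dot u (a *: v) = a * dot u v.
Proof. by rewrite /dot mulr_sumr; apply: eq_bigr => i _; rewrite mxE mulrCA. Qed.

Lemma dotNr u v : dot u (- v) = - dot u v.
Proof. by rewrite -scaleN1r dotZr mulN1r. Qed.

Lemma dotDl u v w : dot (u + v) w = dot u w + dot v w.
Proof. by rewrite dotC dotDr !(dotC w). Qed.

Lemma dotZl (a : R) u v : dot (a *: u) v = a * dot u v.
Proof. by rewrite dotC dotZr dotC. Qed.

Lemma dotNl u v : dot (- u) v = - dot u v.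
Proof. by rewrite dotC dotNr dotC. Qed.

Lemma dot0r u : dot u 0 = 0.
Proof. by rewrite -(scale0r 0) dotZr mul0r. Qed.

Definition dotE := (dotDr, dotDl, dotNr, dotNl, dotZr, dotZl).

Lemma dot_ge0 u : 0 <= dot u u.
Proof. by apply: sumr_ge0 => i _; rewrite -expr2 sqr_ge0. Qed.

Lemma sqr_coord_le_dot u i : u 0 i ^+ 2 <= dot u u.
Proof.
rewrite /dot (bigD1 i)//= -expr2 lerDl.
by apply: sumr_ge0 => j _; rewrite -expr2 sqr_ge0.
Qed.

Lemma dot_eq0 u : dot u u = 0 -> u = 0.
Proof.
move=> u0; apply/rowP => i; apply/eqP; rewrite mxE -sqrf_eq0 eq_le sqr_ge0 andbT.
by rewrite -u0 sqr_coord_le_dot.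
Qed.

Lemma dot_bound u v (e : R) : (forall i, `|u 0 i| <= e) ->
  `|dot u v| <= e * \sum_(i < n) `|v 0 i|.
Proof.
move=> ue; apply: le_trans (ler_norm_sum _ _ _) _; rewrite mulr_sumr.
by apply: ler_sum => i _; rewrite normrM ler_wpM2r.
Qed.

Lemma dot_dist_bound (g g' z : 'rV[R]_n) (e : R) :
  (forall i, `|g' 0 i - g 0 i| <= e) ->
  `|dot g' z - dot g z| <= e * \sum_(i < n) `|z 0 i|.
Proof.
by move=> gg'; rewrite -dotNl -dotDl; apply: dot_bound => i; rewrite !mxE.
Qed.

Lemma dot_sqr_continuous c :
  continuous (fun u : 'rV[R]_n => dot (u - c) (u - c)).
Proof.
apply: (@continuous_big _ _ +%R 0 xpredT) => [|i _]; first exact: add_continuous.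
rewrite [X in continuous X](_ : _ =
    fun u : 'rV[R]_n => (u 0 i - c 0 i) * (u 0 i - c 0 i)).
  move=> x.
  have cv : continuous (fun u : 'rV[R]_n => u 0 i - c 0 i).
    by move=> y; exact: (cvgB (@coord_continuous R 1 n 0 i y) (cvg_cst _)).
  exact: (cvgM (cv x) (cv x)).
by apply/funext => u; rewrite !mxE.
Qed.

Lemma exists_orthogonal2 (n3 : (2 < n)%N) u v :
  exists2 w : 'rV[R]_n, w != 0 & dot u w = 0 /\ dot v w = 0.
Proof.
pose A : 'M[R]_(n, 1 + 1) := row_mx u^T v^T.
have : kermx A != 0.
  rewrite -mxrank_eq0 mxrank_ker -lt0n subn_gt0.
  by apply: leq_ltn_trans n3; exact: rank_leq_col.
case/rowV0Pn => w /sub_kermxP wA w0; exists w => //.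
have dotM x : (w *m x^T) 0 0 = dot x w.
  by rewrite dotC mxE; apply: eq_bigr => i _; rewrite mxE.
move: wA; rewrite /A mul_mx_row => /eqP.
by rewrite row_mx_eq0 => /andP[/eqP wu /eqP wv]; rewrite -!dotM wu wv !mxE.
Qed.

End Dot.

(** Points satisfying [P] with tolerances [k.+1%:R^-1] stay in a box, so they have a cluster point
    [g]. Monotonicity lets a late point of the sequence close to [g] serve for the tolerance [e]. *)
Lemma row_compactness (R : realType) (n : nat) (C : R)
    (P : R -> 'rV[R]_n -> Prop) :
  (forall (e e' : R) g, e <= e' -> P e g -> P e' g) ->
  (forall e : R, 0 < e -> exists2 g : 'rV[R]_n, (forall i, `|g 0 i| <= C) & P e g) ->
  exists g : 'rV[R]_n, forall e : R, 0 < e ->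
    exists2 g' : 'rV[R]_n, (forall i, `|g' 0 i - g 0 i| <= e) & P e g'.
Proof.
move=> Pmono exP.
have /choice[u uP] (k : nat) : exists g : 'rV[R]_n,
    (forall i, `|g 0 i| <= C) /\ P k.+1%:R^-1 g.
  have [|g gC Pg] := exP k.+1%:R^-1; first by rewrite invr_gt0.
  by exists g.
have cpt := @rV_compact R n (fun=> `[- C, C]%classic)
   (fun=> @segment_compact R (- C) C).
have [|g [_ gcl]] := cpt (u @ \oo) _.
  by exists 0%N => // k _ i /=; rewrite in_itv /=; have := (uP k).1 i; rewrite ler_norml.
exists g => _ /posnumP[e].
have := gcl [set u k | k in [set k | k.+1%:R^-1 <= e%:num]] (ball g e%:num) _ _.
case.
- apply: filterS (near_infty_natSinv_lt e) => k /ltW ke.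
  by exists k.
- exact: nbhsx_ballx.
- move=> _ [[k ke <-]] [_ gu]; exists (u k); last exact: Pmono ke (uP k).2.
  by move=> i; rewrite distrC; apply/ltW/gu.
Qed.

Lemma ger_of_small (R : realType) (x y K : R) :
  (forall e : R, 0 < e -> x <= y + e * K) -> x <= y.
Proof.
move=> H; apply/ler_addgt0Pr => e e0.
have K0 : 0 < `|K| + 1 by rewrite ltr_pwDr.
apply: le_trans (H _ (divr_gt0 e0 K0)) _; rewrite lerD2l.
rewrite mulrAC ler_pdivrMr// ler_pM2l//.
by apply: le_trans (ler_norm _) _; rewrite lerDl.
Qed.

(** * Support functionals and density of smooth points *)

Definition is_norm (R : realType) (n : nat) (N : 'rV[R]_n -> R) : Prop :=
  [/\ forall x y, N (x + y) <= N x + N y,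
      forall (a : R) x, N (a *: x) = `|a| * N x
    & forall x, N x = 0 -> x = 0].

(** For nonzero [x] these are the norming functionals of [x], written as rows; for [x = 0] they are
    all functionals of dual norm at most one. *)
Definition supports (R : realType) (n : nat) (N : 'rV[R]_n -> R)
    (x phi : 'rV[R]_n) : Prop :=
  (forall z, dot phi z <= N z) /\ dot phi x = N x.

(* At a nonzero point [x] supported by [phi] this amounts to differentiability
   of [N] at [x], in a form that only compares values of [N]. *)
Definition descends (R : realType) (n : nat) (N : 'rV[R]_n -> R)
    (x phi : 'rV[R]_n) : Prop :=
  forall v, dot phi v < 0 -> exists2 s : R, 0 < s & N (x + s *: v) < N x.

Section NormOnRows.
Variables (R : realType) (n : nat) (N : 'rV[R]_n -> R).
Hypothesis N_norm : is_norm N.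
Implicit Types x y z u v w phi psi : 'rV[R]_n.

Lemma normD x y : N (x + y) <= N x + N y.
Proof. by case: N_norm. Qed.

Lemma normZ (a : R) x : N (a *: x) = `|a| * N x.
Proof. by case: N_norm. Qed.

Lemma norm_eq0 x : N x = 0 -> x = 0.
Proof. by case: N_norm => _ _; exact. Qed.

Lemma norm0 : N 0 = 0.
Proof. by rewrite -(scale0r 0) normZ normr0 mul0r. Qed.

Lemma normN x : N (- x) = N x.
Proof. by rewrite -scaleN1r normZ normrN1 mul1r. Qed.

Lemma norm_ge0 x : 0 <= N x.
Proof.
have := normD x (- x); rewrite subrr norm0 normN.
by lra.
Qed.

Lemma norm_gt0 x : x != 0 -> 0 < N x.
Proof.
move=> x0; rewrite lt_neqAle norm_ge0 andbT eq_sym.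
by apply: contra x0 => /eqP/norm_eq0 ->.
Qed.

Lemma normB_ge x y : N x - N y <= N (x + y).
Proof.
have := normD (x + y) (- y); rewrite addrK normN.
by lra.
Qed.

Lemma norm_bound x (e : R) : (forall i, `|x 0 i| <= e) ->
  N x <= e * \sum_(i < n) N (delta_mx 0 i).
Proof.
move=> xe; rewrite [x in N x]row_sum_delta mulr_sumr.
elim/big_ind2: _ => [|x1 r1 x2 r2 h1 h2|i _].
- by rewrite norm0.
- by apply: le_trans (normD _ _) _; exact: lerD.
- by rewrite normZ ler_wpM2r ?norm_ge0.
Qed.

Lemma norm_continuous : continuous N.
Proof.
move=> x; apply/(@cvgrPdist_le _ _ _ _ (nbhs_filter x)) => e e0.
pose K := \sum_(i < n) N (delta_mx 0 i).
have K0 : 0 <= K by apply: sumr_ge0 => i _; exact: norm_ge0.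
have K1 : 0 < K + 1 by rewrite ltr_wpDl.
have d0 : 0 < e / (K + 1) by rewrite divr_gt0.
apply: filterS (nbhsx_ballx x _ d0) => y [_ xy].
have Nxy : N (x - y) <= e.
  apply: (@le_trans _ _ (e / (K + 1) * K)).
    by apply: norm_bound => i; rewrite !mxE; apply/ltW/xy.
  by rewrite mulrAC ler_pdivrMr// ler_pM2l// lerDl.
have := normD y (x - y); have := normD x (y - x).
rewrite !subrKC -[y - x]opprB normN ler_norml => h1 h2.
by apply/andP; split; lra.
Qed.

Lemma supports_lower x phi z : supports N x phi -> - N z <= dot phi z.
Proof. by move=> [/(_ (- z)) + _]; rewrite dotNr normN; lra. Qed.

Lemma supportsN x phi : supports N x phi -> supports N (- x) (- phi).
Proof.
move=> [le_phi phix]; split; last by rewrite dotNl dotNr opprK normN.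
by move=> z; rewrite dotNl -dotNr -[N z]normN.
Qed.

Lemma supportsZ (a : R) x phi : 0 <= a -> supports N x phi ->
  supports N (a *: x) phi.
Proof.
by move=> a0 [le_phi phix]; split => //; rewrite dotZr phix normZ ger0_norm.
Qed.

(** It suffices to rescale [w] so that its value at [x] is [N x]. If [w] were not positive at [x],
    or not dominated by [N] after rescaling, it would be negative on a direction along which the
    triangle inequality forbids the norm to decrease. *)
Lemma descends_supports x w : x != 0 -> w != 0 -> descends N x w ->
  exists2 phi, supports N x phi & descends N x phi.
Proof.
move=> x0 w0 desc; have Nx := norm_gt0 x0; have Nw := norm_gt0 w0.
have wx : 0 < dot w x.
  rewrite ltNge; apply/negP => wx.
  have [|s s0] := desc (x - (N x / N w) *: w).
    rewrite !dotE.
    have ww : 0 < dot w w.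
      rewrite lt_neqAle dot_ge0 andbT eq_sym.
      by apply: contra w0 => /eqP/dot_eq0 ->.
    by have := mulr_gt0 (divr_gt0 Nx Nw) ww; lra.
  have := normB_ge ((1 + s) *: x) (- (s * (N x / N w)) *: w).
  have s1 : 0 <= 1 + s by lra.
  have s2 : 0 <= s * (N x / N w) by rewrite mulr_ge0 ?divr_ge0// ltW.
  rewrite !normZ normrN !ger0_norm//.
  rewrite -!mulrA mulVf ?gt_eqF// mulr1.
  rewrite [X in _ <= N X -> _](_ : _ = x + s *: (x - (N x / N w) *: w)); first by nra.
  by apply/rowP => i; rewrite !mxE; ring.
pose phi := (N x / dot w x) *: w.
have c0 : 0 < N x / dot w x by rewrite divr_gt0.
have phix : dot phi x = N x by rewrite dotZl divfK// gt_eqF.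
have descphi : descends N x phi.
  by move=> v; rewrite dotZl pmulr_rlt0//; exact: desc.
exists phi => //; split => // z; rewrite leNgt; apply/negP => zphi.
(* [b * N x] lies halfway between [N z] and [dot phi z]: [phi] is negative at [b *: x - z], but the
   norm grows in that direction. *)
pose b := (dot phi z + N z) / (2 * N x).
have bx : b * N x = (dot phi z + N z) / 2.
  by rewrite /b; field; rewrite gt_eqF.
have b0 : 0 <= b.
  rewrite divr_ge0//; last by lra.
  by have := norm_ge0 z; lra.
have [|s s0] := descphi (b *: x - z); first by rewrite dotDr dotNr dotZr phix bx; lra.
have := normB_ge ((1 + s * b) *: x) (- s *: z).
have s1 : 0 <= 1 + s * b by nra.
rewrite !normZ normrN !ger0_norm//; last exact: ltW.
rewrite [X in _ <= N X -> _](_ : _ = x + s *: (b *: x - z)); first by nra.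
by apply/rowP => i; rewrite !mxE; ring.
Qed.

(* The witness is the point of [{N >= 1}] nearest, in the Euclidean norm, to a
   point slightly inside the sphere near [e]: it is smooth because a Euclidean
   ball inside [{N <= 1}] touches the sphere there. *)
Lemma smooth_near e (d : R) : e != 0 -> 0 < d ->
  exists x phi, [/\ N (x - e) <= d, x != 0, supports N x phi & descends N x phi].
Proof.
wlog Ne1 : e d / N e = 1 => [hw|_ d0].
  move=> e0 d0; have Ne := norm_gt0 e0.
  have d'0 : 0 < d / N e by rewrite divr_gt0.
  have [|||x [phi [xe x0 sx dx]]] := hw ((N e)^-1 *: e) (d / N e).
  - by rewrite normZ ger0_norm ?mulVf ?gt_eqF// invr_ge0 ltW.
  - by rewrite scaler_eq0 negb_or invr_eq0 gt_eqF.
  - by [].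
  exists (N e *: x), phi; split.
  - rewrite (_ : _ - e = N e *: (x - (N e)^-1 *: e)).
      by rewrite normZ gtr0_norm// mulrC -ler_pdivlMr.
    by rewrite scalerBr scalerA divff ?gt_eqF// scale1r.
  - by rewrite scaler_eq0 negb_or gt_eqF.
  - exact: supportsZ (ltW Ne) sx.
  - move=> v pv; have [s s0 Ns] := dx v pv; exists (N e * s).
      by rewrite mulr_gt0.
    by rewrite -scalerA -scalerDr !normZ ltr_pM2l// gtr0_norm.
pose K := dot e e + 1; pose C := \sum_(i < n) N (delta_mx 0 i).
have C0 : 0 <= C by apply: sumr_ge0 => i _; exact: norm_ge0.
have K0 : 1 <= K by have := dot_ge0 e; rewrite /K; lra.
have KC0 : 0 <= K * C by nra.
(* The final estimate of [N (x - e)] is [h * K * C + h], hence at most [d]; [0 < h <= 1 / 2] puts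
   [c] strictly inside the unit ball. *)
pose h := Num.min (1 / 2) (d / (K * C + 1)).
have h0 : 0 < h.
  by rewrite lt_min; apply/andP; split; [lra|rewrite divr_gt0//; lra].
have h1 : h <= 1 / 2 by rewrite ge_min lexx.
have hd : h * (K * C + 1) <= d.
  by rewrite -ler_pdivlMr ?ge_min ?lexx ?orbT//; lra.
pose c := (1 - h) *: e.
pose q z := dot (z - c) (z - c).
have ec : e - c = h *: e by apply/rowP => i; rewrite !mxE; ring.
have qe : q e = h ^+ 2 * dot e e by rewrite /q ec !dotE; ring.
have qK z : q z <= q e -> forall i, `|(z - c) 0 i| <= h * K.
  move=> zq i; rewrite -ler_sqr ?nnegrE; [|by []|nra].
  rewrite real_normK ?num_real//.
  apply: le_trans (sqr_coord_le_dot _ _) (le_trans zq _).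
  rewrite qe exprMn ler_pM2l ?exprn_gt0//.
  by have := dot_ge0 e; rewrite /K; nra.
(* Cutting [{N >= 1}] by the Euclidean ball around [c] through [e] makes it compact; points outside
   that ball are farther from [c], so the minimum over [A] is global. *)
pose A := [set z | 1 <= N z] `&` [set z | q z <= q e].
have cA : compact A.
  apply: (subclosed_compact (B := [set v : 'rV[R]_n |
      forall i, `[- (h * K + `|c|), h * K + `|c|]%classic (v ord0 i)])).
  - apply: closedI.
      apply: (@preimage_closed _ _ N [set t | 1 <= t]) => [x _|].
        exact: norm_continuous.
      exact: closed_ge.
    apply: (@preimage_closed _ _ q [set t | t <= q e]) => [x _|].
      exact: dot_sqr_continuous.
    exact: closed_le.
  - apply: (@rV_compact R n (fun=> `[- (h * K + `|c|), h * K + `|c|]%classic)).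
    by move=> _; exact: segment_compact.
  - move=> z [_ /= /qK zK] i; rewrite in_itv/= -ler_norml.
    have -> : z ord0 i = (z - c) 0 i + c 0 i by rewrite !mxE; ring.
    apply: le_trans (ler_normD _ _) _; apply: lerD => //.
    rewrite [leRHS]/Num.Def.normr/= mx_normrE; apply: le_trans (le_bigmax _ _ (0, i)).
    by [].
have A0 : A !=set0 by exists e; rewrite /A/= Ne1.
have [|x xA xmin] := compact_EVT_min (f := q) A0 cA.
  by apply: continuous_subspaceT; exact: dot_sqr_continuous.
move: xA; rewrite inE => -[/= Nx1 /[dup] qx /qK xK].
have {}xmin z : 1 <= N z -> q x <= q z.
  move=> Nz; have [zq|zq] := leP (q z) (q e); first by apply: xmin; rewrite inE.
  exact: le_trans qx (ltW zq).
have x0 : x != 0.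
  by apply: contraTneq Nx1 => ->; rewrite norm0 ler10.
have w0 : x - c != 0.
  rewrite subr_eq0; apply: contraTneq Nx1 => ->.
  by rewrite normZ Ne1 gtr0_norm; lra.
have [v wv|phi sx dx] := @descends_supports x (x - c) x0 w0 _.
  have vv := dot_ge0 v.
  (* A move by this [s] along [v] strictly decreases the Euclidean distance to [c], so minimality of
     [x] forces [N < 1] at the new point. *)
  pose s := - dot (x - c) v / (dot v v + 1).
  have s0 : 0 < s by rewrite divr_gt0//; lra.
  have sv : s * (dot v v + 1) = - dot (x - c) v by rewrite /s; field; lra.
  clearbody s; exists s => //; apply: lt_le_trans Nx1; rewrite ltNge; apply/negP => /xmin.
  rewrite /q (_ : x + _ - c = (x - c) + s *: v); last by rewrite addrAC.
  move: (x - c) sv wv => w sv wv; rewrite !(dotDr, dotDl, dotZr, dotZl) (dotC v w).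
  have := congr1 ( *%R s) sv; have := mulr_gt0 s0 s0.
  have : s * dot w v < 0 by rewrite pmulr_rlt0.
  by lra.
exists x, phi; split => //.
have -> : x - e = (x - c) - h *: e.
  by rewrite -ec; apply/rowP => i; rewrite !mxE; ring.
apply: le_trans (normD _ _) _; rewrite normN normZ Ne1 gtr0_norm//.
have := norm_bound xK; rewrite -/C; lra.
Qed.

End NormOnRows.

(** * Smoothness of the norm from norm-one projections *)

Section SmoothSupports.
Variables (R : realType) (n : nat) (N : 'rV[R]_n -> R).
Hypothesis N_norm : is_norm N.
Implicit Types x y z u v w phi psi : 'rV[R]_n.

Lemma supports_nearby x y phi : supports N y phi ->
  N x - 2 * N (y - x) <= dot phi x.
Proof.
move=> [/(_ (y - x)) + phiy]; rewrite dotDr dotNr phiy.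
have := normD N_norm y (x - y).
rewrite subrKC -[x - y]opprB (normN N_norm).
by lra.
Qed.

(** Functionals dominated by [N] have bounded coordinates, so compactness turns approximate support
    functionals into an exact one. *)
Lemma supports_limit x v (c : R) :
  (forall e : R, 0 < e -> exists phi, [/\ forall z, dot phi z <= N z,
     N x - e <= dot phi x & c - e <= dot phi v]) ->
  exists2 phi, supports N x phi & c <= dot phi v.
Proof.
move=> H.
pose P (e : R) phi := [/\ forall z, dot phi z <= N z,
  N x - e <= dot phi x & c - e <= dot phi v].
have [||g gP] := @row_compactness R n (\sum_(i < n) N (delta_mx 0 i)) P.
- by move=> e e' phi ee' [h1 h2 h3]; split => //; lra.
- move=> e /H[phi [h1 h2 h3]]; exists phi => // i.
  have dotd u : dot u (delta_mx 0 i) = u 0 i.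
    rewrite /dot (bigD1 i)//= mxE !eqxx mulr1 big1 ?addr0// => j ji.
    by rewrite mxE (negbTE ji) mulr0.
  have le_i : N (delta_mx 0 i) <= \sum_(i < n) N (delta_mx 0 i).
    rewrite (bigD1 i)//= lerDl; apply: sumr_ge0 => j _; exact: norm_ge0.
  apply: le_trans le_i; rewrite -dotd ler_norml h1 andbT.
  by rewrite lerNl -dotNr -(normN N_norm).
exists g; first split.
- move=> z; apply: (@ger_of_small _ _ _ (\sum_(i < n) `|z 0 i|)) => e /gP[g'].
  move=> /(dot_dist_bound z) + [/(_ z) ? _ _]; rewrite ler_norml => /andP[? ?]; lra.
- apply/eqP; rewrite eq_le; apply/andP; split.
    apply: (@ger_of_small _ _ _ (\sum_(i < n) `|x 0 i|)) => e /gP[g'].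
    by move=> /(dot_dist_bound x) + [/(_ x) ? _ _]; rewrite ler_norml => /andP[? ?]; lra.
  apply: (@ger_of_small _ _ _ (\sum_(i < n) `|x 0 i| + 1)) => e /gP[g'].
  by move=> /(dot_dist_bound x) + [_ ? _]; rewrite ler_norml => /andP[? ?]; lra.
- apply: (@ger_of_small _ _ _ (\sum_(i < n) `|v 0 i| + 1)) => e /gP[g'].
  by move=> /(dot_dist_bound v) + [_ _ ?]; rewrite ler_norml => /andP[? ?]; lra.
Qed.

(** This replaces Hahn-Banach: smooth points approach [x], and their support functionals have a
    limit. *)
Lemma supports_exists x : exists phi, supports N x phi.
Proof.
have [->|x0] := eqVneq x 0.
  exists 0; split => [z|]; last by rewrite dot0r norm0.
  by rewrite dotC dot0r; exact: norm_ge0.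
have [|phi sx _] := @supports_limit x 0 0; last by exists phi.
move=> e e0; have [|y [phi [yx _ sy _]]] := @smooth_near R n N N_norm x (e / 2) x0.
  by rewrite divr_gt0.
exists phi; split; [exact: sy.1| |by rewrite dot0r; lra].
by have := supports_nearby x sy; lra.
Qed.

(** A functional supporting [x + s *: v] is at most [N x] at [x] and at least [N x] at [x + s *: v],
    so it is nonnegative at [v]; let [s] tend to zero. *)
Lemma supports_nondescent x v : (forall s : R, 0 < s -> N x <= N (x + s *: v)) ->
  exists2 phi, supports N x phi & 0 <= dot phi v.
Proof.
move=> xv; apply: supports_limit => e e0.
have Nv := norm_ge0 N_norm v.
pose s := e / (2 * N v + 1).
have s0 : 0 < s by rewrite divr_gt0//; lra.
have se : s * (2 * N v + 1) = e by rewrite /s; field; lra.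
have [phi sphi] := supports_exists (x + s *: v); exists phi.
split; first exact: sphi.1.
- have := supports_nearby x sphi.
  rewrite addrAC subrr add0r (normZ N_norm) gtr0_norm//; lra.
- have := xv s s0; have := sphi.1 x; rewrite -sphi.2 dotDr dotZr.
  have [//|h] := leP (0 - e) (dot phi v).
  have : s * dot phi v < 0 by rewrite pmulr_rlt0//; lra.
  by lra.
Qed.

Hypothesis proj : forall v : 'rV[R]_n, v != 0 ->
  exists2 g, dot g v = 1 & forall x, N (x - dot g x *: v) <= N x.

(** The projection along [v] forces [dot g x1 < 0] and [dot g x2 <= 0], hence [dot g (x1 + x2) < 0].
    Projecting [x1 + x2] then adds a positive multiple of [v] without increasing the norm, so [phi]
    cannot be positive at [v]. *)
Lemma supports_add x1 x2 phi1 phi2 phi v :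
  descends N x1 phi1 -> supports N x2 phi2 -> supports N (x1 + x2) phi ->
  dot phi1 v < 0 -> dot phi2 v < 0 -> dot phi v <= 0.
Proof.
move=> d1 s2 s3 v1 v2.
have v0 : v != 0 by apply: contraTneq v1 => ->; rewrite dot0r ltxx.
have [g gv gP] := proj v0.
(* Otherwise [x1] lies between [x1 + s *: v], of smaller norm, and the projection of that point,
   whose norm is no larger: this contradicts convexity. *)
have g1 : dot g x1 < 0.
  rewrite ltNge; apply/negP => g1.
  have [s s0 ltN] := d1 v v1.
  have := gP (x1 + s *: v); rewrite dotDr dotZr gv mulr1.
  rewrite (_ : x1 + s *: v - _ = x1 - dot g x1 *: v); last first.
    by apply/rowP => i; rewrite !mxE; ring.
  move: (dot g x1) g1 => t t0 leN.
  have : (s + t) *: x1 = s *: (x1 - t *: v) + t *: (x1 + s *: v).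
    by apply/rowP => i; rewrite !mxE; ring.
  move/(congr1 N); have := normD N_norm (s *: (x1 - t *: v)) (t *: (x1 + s *: v)).
  have st : 0 <= s + t by lra.
  rewrite !(normZ N_norm) !ger0_norm// ?(ltW s0)//.
  have := ler_wpM2l (ltW s0) leN; have : (s + t) * N (x1 + s *: v) < (s + t) * N x1.
    by rewrite ltr_pM2l//; lra.
  by lra.
have g2 : dot g x2 <= 0.
  rewrite leNgt; apply/negP => g2.
  have := gP x2; rewrite -s2.2; apply/negP; rewrite -ltNge.
  apply: lt_le_trans (s2.1 _); rewrite dotDr dotNr dotZr.
  have : dot g x2 * dot phi2 v < 0 by rewrite pmulr_rlt0.
  by lra.
have := le_trans (s3.1 _) (gP (x1 + x2)).
rewrite -s3.2 (dotDr phi _ (- _)) dotNr dotZr (dotDr g).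
by nra.
Qed.

(** Adding a multiple of [k] to [w] keeps [phi1] and [phi2] negative, but could give [phi] the value
    1 if [dot phi k] were nonzero. *)
Lemma supports_add_ker x1 x2 phi1 phi2 phi w k :
  descends N x1 phi1 -> supports N x2 phi2 -> supports N (x1 + x2) phi ->
  dot phi1 w < 0 -> dot phi2 w < 0 ->
  dot phi1 k = 0 -> dot phi2 k = 0 -> dot phi k = 0.
Proof.
move=> d1 s2 s3 w1 w2 k1 k2; apply/eqP/negP => /negP k0.
have := @supports_add x1 x2 phi1 phi2 phi
  (w + ((1 - dot phi w) / dot phi k) *: k) d1 s2 s3.
rewrite !dotDr !dotZr k1 k2 !mulr0 !addr0 divfK// => /(_ w1 w2).
by lra.
Qed.

Hypothesis n3 : (2 < n)%N.

(** If [v] fails to descend, a second functional [psi] supports [x]. Take [x1] smooth near a vector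
    [e] of both kernels, and [phi2] supporting [c *: x - x1]. By [supports_add_ker], [phi] and [psi]
    lie in the span of [phi1] and [phi2]; being independent, they would span [phi1], which is
    nonzero at [e]. *)
Lemma supports_descends x phi : x != 0 -> supports N x phi -> descends N x phi.
Proof.
move=> x0 sx v v0; apply: contrapT => nodesc.
have [s s0|psi tx psiv] := @supports_nondescent x v.
  by rewrite leNgt; apply/negP => ?; apply: nodesc; exists s.
have Nx := norm_gt0 N_norm x0.
have [e e0 [phie psie]] := exists_orthogonal2 n3 phi psi.
have Ne := norm_gt0 N_norm e0.
have [|x1 [phi1 [x1e x10 s1 d1]]] := @smooth_near R n N N_norm e (N e / 4) e0.
  by rewrite divr_gt0.
have phi1e : 0 < dot phi1 e by have := supports_nearby e s1; lra.
have Nx1 := norm_gt0 N_norm x10.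
(* The situation is invariant under changing the signs of [x], [phi], [psi] and [v] together. *)
wlog phi1x : x phi psi v x0 sx v0 nodesc tx psiv Nx phie psie / 0 <= dot phi1 x.
  move=> hw; have [|h] := leP 0 (dot phi1 x).
    exact: (hw x phi psi v).
  apply: (hw (- x) (- phi) (- psi) (- v)).
  - by rewrite oppr_eq0.
  - exact: supportsN.
  - by rewrite dotNl dotNr opprK.
  - move=> [s s0 h1]; apply: nodesc; exists s => //.
    by move: h1; rewrite scalerN -opprD !(normN N_norm).
  - exact: supportsN.
  - by rewrite dotNl dotNr opprK.
  - by rewrite (normN N_norm).
  - by rewrite dotNl phie oppr0.
  - by rewrite dotNl psie oppr0.
  - by rewrite dotNr; lra.
(* This [c] gives [phi2] a value of at least [N x1 + 1] at [c *: x - x1], while [phi1] stays above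
   [- N x1]; taking [l * N x1] between [N x1] and [N x1 + 1] then makes both negative at [w]. *)
pose c := (2 * N x1 + 1) / N x.
have c0 : 0 < c by rewrite divr_gt0//; lra.
have cx : c * N x = 2 * N x1 + 1 by rewrite divfK// gt_eqF.
have [phi2 s2] := supports_exists (c *: x - x1).
have x12 : x1 + (c *: x - x1) = c *: x by rewrite subrKC.
have phi2x2 : N x1 + 1 <= dot phi2 (c *: x - x1).
  rewrite s2.2; have := normB_ge N_norm (c *: x) (- x1).
  by rewrite (normZ N_norm) gtr0_norm// (normN N_norm); lra.
have phi1x2 : - N x1 <= dot phi1 (c *: x - x1).
  by rewrite dotDr dotNr dotZr s1.2; have := mulr_ge0 (ltW c0) phi1x; lra.
have phi2x1 := supports_lower N_norm x1 s2.
pose l := (N x1 + 1 / 2) / N x1.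
have lx : l * N x1 = N x1 + 1 / 2 by rewrite divfK// gt_eqF.
have l0 : 0 < l by rewrite divr_gt0//; lra.
pose w := - (c *: x - x1 + l *: x1).
have w1 : dot phi1 w < 0 by rewrite dotNr dotDr dotZr s1.2; lra.
have w2 : dot phi2 w < 0.
  rewrite dotNr dotDr dotZr.
  have : l * - N x1 <= l * dot phi2 x1 by rewrite ler_pM2l.
  by lra.
have ker k : dot phi1 k = 0 -> dot phi2 k = 0 -> dot phi k = 0 /\ dot psi k = 0.
  move=> k1 k2; split.
  - apply: (@supports_add_ker x1 _ phi1 phi2 phi w k) d1 s2 _ w1 w2 k1 k2.
    by rewrite x12; apply: supportsZ => //; exact: ltW.
  - apply: (@supports_add_ker x1 _ phi1 phi2 psi w k) d1 s2 _ w1 w2 k1 k2.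
    by rewrite x12; apply: supportsZ => //; exact: ltW.
(* Subtracting multiples of [e] reaches the kernel of [phi1] without changing [phi] and [psi]. On
   the plane of [x'] and [v'] these two are independent, yet both vanish wherever [phi2] does. *)
pose x' := x - (dot phi1 x / dot phi1 e) *: e.
pose v' := v - (dot phi1 v / dot phi1 e) *: e.
have x'1 : dot phi1 x' = 0.
  by rewrite dotDr dotNr dotZr divfK ?subrr// gt_eqF.
have v'1 : dot phi1 v' = 0.
  by rewrite dotDr dotNr dotZr divfK ?subrr// gt_eqF.
have phix' : dot phi x' = N x by rewrite dotDr dotNr dotZr phie sx.2; lra.
have psix' : dot psi x' = N x by rewrite dotDr dotNr dotZr psie tx.2; lra.
have phiv' : dot phi v' = dot phi v by rewrite dotDr dotNr dotZr phie; lra.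
have psiv' : dot psi v' = dot psi v by rewrite dotDr dotNr dotZr psie; lra.
clearbody x' v'.
have [||h1 h2] := ker (dot phi2 v' *: x' - dot phi2 x' *: v').
- by rewrite dotDr dotNr !dotZr x'1 v'1; lra.
- by rewrite dotDr dotNr !dotZr; lra.
have x'2 : dot phi2 x' = 0.
  move: h1 h2; rewrite !dotDr !dotNr !dotZr phix' psix' phiv' psiv' => h1 h2.
  have : dot phi2 x' * (dot psi v - dot phi v) = 0 by lra.
  move/eqP; rewrite mulf_eq0 => /orP[/eqP//|/eqP]; lra.
have [h _] := ker x' x'1 x'2; move: h; rewrite phix'; lra.
Qed.

End SmoothSupports.

(** * Reflections, strict convexity and Euclidean planes *)

(** Over a subdivision into [m.+1] equal steps the bounds telescope to [K * (h 1 - h 0)] divided by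
    [m.+1], which tends to zero. *)
Lemma eq_of_telescoping_bound (R : realType) (f h : R -> R) (K : R) :
  (forall s s', 0 <= s -> s < s' -> s' <= 1 ->
     `|f s' - f s| <= K * (s' - s) * (h s' - h s)) ->
  f 0 = f 1.
Proof.
move=> fh; apply/eqP; rewrite eq_sym -subr_eq0 -normr_le0.
suff bound (m : nat) : `|f 1 - f 0| <= m.+1%:R^-1 * (K * (h 1 - h 0)).
  apply: (@ger_of_small _ _ _ (`|K * (h 1 - h 0)|)) => e e0; rewrite add0r.
  have [m me] : exists m : nat, m.+1%:R^-1 <= e.
    have [m _ me] := near_infty_natSinv_lt (PosNum e0).
    by exists m; apply/ltW/me => /=.
  apply: le_trans (bound m) _.
  apply: le_trans (ler_wpM2l _ (ler_norm _)) _; first by rewrite invr_ge0.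
  by rewrite ler_wpM2r.
have m0 : 0 < m.+1%:R^-1 :> R by rewrite invr_gt0.
suff step (k : nat) : (k <= m.+1)%N ->
    `|f (k%:R / m.+1%:R) - f 0| <=
    m.+1%:R^-1 * (K * (h (k%:R / m.+1%:R) - h 0)).
  by have := step m.+1 (leqnn _); rewrite divff.
elim: k => [_|k IH km]; first by rewrite mul0r !subrr normr0 !mulr0.
have {}IH := IH (ltnW km).
have kk : k.+1%:R / m.+1%:R - k%:R / m.+1%:R = m.+1%:R^-1 :> R.
  by rewrite -mulrBl -natrB// subSnn mul1r.
have k1 : k.+1%:R / m.+1%:R <= 1 :> R by rewrite ler_pdivrMr// mul1r ler_nat.
have := fh (k%:R / m.+1%:R) (k.+1%:R / m.+1%:R).
rewrite kk divr_ge0// -subr_gt0 kk m0 k1 => /(_ isT isT isT) h1.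
have := ler_normD (f (k.+1%:R / m.+1%:R) - f (k%:R / m.+1%:R))
  (f (k%:R / m.+1%:R) - f 0).
rewrite addrA subrK; move: IH h1.
move: (`|_|) (`|_|) (`|_|) (h _) (h _) (h _) => A B C hk h0 hk1.
by move: (m.+1%:R^-1) => d; lra.
Qed.

Section Reflections.
Variables (R : realType) (n : nat) (N : 'rV[R]_n -> R).
Hypothesis N_norm : is_norm N.
Hypothesis proj : forall v : 'rV[R]_n, v != 0 ->
  exists2 g, dot g v = 1 & forall x, N (x - dot g x *: v) <= N x.
Hypothesis n3 : (2 < n)%N.
Implicit Types (x y z u v w phi psi : 'rV[R]_n) (t : R).

Lemma unit_neq0 x : N x = 1 -> x != 0.
Proof.
by move=> Nx; apply: contra_eq_neq Nx => ->; rewrite (norm0 N_norm) eq_sym oner_eq0.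
Qed.

Lemma normalized x : x != 0 -> N ((N x)^-1 *: x) = 1.
Proof.
move=> /(norm_gt0 N_norm) Nx.
by rewrite (normZ N_norm) gtr0_norm ?invr_gt0// mulVf// gt_eqF.
Qed.

(* [x + t *: a] is supported by a combination of [phi] and [al]. *)
Lemma section_variation a al x x' phi t : a != 0 -> supports N a al ->
  dot al x = 0 -> dot al x' = 0 -> N x = 1 -> N x' = 1 -> supports N x phi ->
  N (x + t *: a) - N (x' + t *: a) <= 1 - dot phi x'.
Proof.
move=> a0 sa alx alx' Nx Nx' sx.
have phix' : dot phi x' <= 1 by rewrite -Nx'; exact: sx.1.
have [->|t0] := eqVneq t 0; first by rewrite !scale0r !addr0 Nx Nx'; lra.
have dx := supports_descends N_norm proj n3 (unit_neq0 Nx) sx.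
have Nta : 0 < N (t *: a) by rewrite (norm_gt0 N_norm)// scaler_eq0 negb_or t0.
have [psi spsi] := supports_exists N_norm (x + t *: a).
(* Then [dot psi x' = dot phi x' * dot psi x], so passing from [x] to [x'] costs [psi] at most
   [1 - dot phi x']. *)
suff psik : dot psi (x' - dot phi x' *: x) = 0.
  move: psik; rewrite dotDr dotNr dotZr => psik.
  have := spsi.1 (x' + t *: a); have := spsi.1 x; rewrite -spsi.2 !dotDr Nx.
  by nra.
have [be sbe [bex bex']] : exists2 be, supports N (t *: a) be &
    dot be x = 0 /\ dot be x' = 0.
  have [tpos|tneg] := ltP 0 t.
    by exists al; [apply: (supportsZ N_norm) => //; exact: ltW|].
  exists (- al); last by rewrite !dotNl alx alx' oppr0.
  rewrite -[t]opprK scaleNr -scalerN.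
  by apply: (supportsZ N_norm); [lra|exact: supportsN].
apply: (supports_add_ker N_norm proj
  (w := - ((N (t *: a) + 1) *: x + t *: a)) dx sbe spsi).
- rewrite dotNr dotDr dotZr sx.2 Nx.
  by have := supports_lower N_norm (t *: a) sx; lra.
- by rewrite dotNr dotDr dotZr bex sbe.2; lra.
- by rewrite dotDr dotNr dotZr sx.2 Nx; lra.
- by rewrite dotDr dotNr dotZr bex bex'; lra.
Qed.

(** Follow the normalized segment from [x] to [x']. Between two of its points [section_variation]
    gives a second-order bound: the step length times the increment of the derivative of [N] along
    [x' - x]. Such bounds telescope. *)
Lemma section_constant a al x x' phi t : a != 0 -> supports N a al ->
  dot al x = 0 -> dot al x' = 0 -> N x = 1 -> N x' = 1 ->
  supports N x phi -> dot phi x' = 0 -> N (x + t *: a) = N (x' + t *: a).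
Proof.
move=> a0 sa alx alx' Nx Nx' sx phix'.
pose z s := (1 - s) *: x + s *: x'.
(* The lower bounds [1 - s] and [2 * s - 1] meet at [s = 2 / 3], where both are [1 / 3]; hence the
   constant 3 below. *)
have Nz s : 0 <= s -> s <= 1 -> 1 / 3 <= N (z s).
  move=> s0 s1; have := sx.1 (z s); rewrite dotDr !dotZr phix' sx.2 Nx.
  have := normB_ge N_norm (s *: x') ((1 - s) *: x).
  have s2 : 0 <= 1 - s by lra.
  by rewrite (addrC (s *: x')) !(normZ N_norm) Nx Nx' !ger0_norm//; lra.
have /choice[ph sph] s : exists phi, supports N (z s) phi.
  exact: supports_exists.
pose f s := N ((N (z s))^-1 *: z s + t *: a).
have f01 : f 0 = f 1.
  apply: (@eq_of_telescoping_bound _ f (fun s => dot (ph s) (x' - x)) 3).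
  move=> s s' s0 ss' s'1.
  have var r r' : 0 <= r -> r <= 1 -> 0 <= r' -> r' <= 1 ->
      f r - f r' <= 3 * ((r' - r) * (dot (ph r') (x' - x) - dot (ph r) (x' - x))).
    move=> r0 r1 r'0 r'1.
    have N0 := Nz _ r0 r1; have N'0 := Nz _ r'0 r'1.
    have zr0 : z r != 0.
      by apply: contraTneq N0 => ->; rewrite (norm0 N_norm); lra.
    have zr'0 : z r' != 0.
      by apply: contraTneq N'0 => ->; rewrite (norm0 N_norm); lra.
    have alz q : dot al (z q) = 0 by rewrite dotDr !dotZr alx alx' !mulr0 addr0.
    apply: (@le_trans _ _ (1 - dot (ph r) ((N (z r'))^-1 *: z r'))).
      apply: (section_variation t a0 sa).
      - by rewrite dotZr alz mulr0.
      - by rewrite dotZr alz mulr0.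
      - exact: normalized.
      - exact: normalized.
      - by apply: (supportsZ N_norm); [rewrite invr_ge0 (norm_ge0 N_norm)|].
    have zd : z r' = z r + (r' - r) *: (x' - x).
      by apply/rowP => i; rewrite !mxE; ring.
    have e1 : dot (ph r') (z r') - dot (ph r) (z r') <=
        (r' - r) * (dot (ph r') (x' - x) - dot (ph r) (x' - x)).
      rewrite zd !(dotDr _ (z r)) !(dotZr (r' - r)) (sph r).2.
      by have := (sph r').1 (z r); lra.
    apply: (le_trans _ (ler_wpM2l _ e1)); last by lra.
    rewrite dotZr (sph r').2.
    have : 0 <= N (z r') - dot (ph r) (z r').
      by rewrite subr_ge0; exact: (sph r).1.
    have h3 : (N (z r'))^-1 <= 3.
      by rewrite invf_ple ?posrE; [|lra..]; lra.
    have : (N (z r'))^-1 * N (z r') = 1 by rewrite mulVf// gt_eqF//; lra.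
    move: h3; move: (N (z r'))^-1 (N (z r')) (dot _ (z r')) => p q c.
    by nra.
  have v1 := var s s' s0 (ltW (lt_le_trans ss' s'1)) (le_trans s0 (ltW ss')) s'1.
  have v2 := var s' s (le_trans s0 (ltW ss')) s'1 s0 (ltW (lt_le_trans ss' s'1)).
  by rewrite ler_norml; apply/andP; split; lra.
move: f01; rewrite /f /z subr0 subrr !scale1r !scale0r addr0 add0r.
by rewrite Nx Nx' invr1 !scale1r.
Qed.

(** Dimension three provides a unit [m'] killed by [al] and by a functional supporting [m];
    [section_constant] links both [m] and [- m] to it. *)
Lemma reflection a al m t : a != 0 -> supports N a al -> dot al m = 0 ->
  N (m + t *: a) = N (m - t *: a).
Proof.
move=> a0 sa alm.
have [->|m0] := eqVneq m 0; first by rewrite !add0r (normN N_norm).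
wlog Nm : m t m0 alm / N m = 1 => [hw|].
  have Nm := norm_gt0 N_norm m0.
  have := hw ((N m)^-1 *: m) ((N m)^-1 * t) _ _ (normalized m0).
  rewrite scaler_eq0 negb_or invr_eq0 gt_eqF// m0 dotZr alm mulr0.
  rewrite -scalerA -scalerBr -scalerDr !(normZ N_norm) => /(_ isT erefl).
  by apply: mulfI; rewrite normr_eq0 invr_eq0 gt_eqF.
have [mu smu] := supports_exists N_norm m.
have [w w0 [alw muw]] := exists_orthogonal2 n3 al mu.
pose m' := (N w)^-1 *: w.
have Nm' : N m' = 1 by exact: normalized.
have alm' : dot al m' = 0 by rewrite dotZr alw mulr0.
have mum' : dot mu m' = 0 by rewrite dotZr muw mulr0.
rewrite (section_constant t a0 sa alm alm' Nm Nm' smu mum').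
rewrite -(@section_constant a al (- m) m' (- mu) t)//.
- by rewrite -(normN N_norm) opprD opprK.
- by rewrite dotNr alm oppr0.
- by rewrite (normN N_norm).
- exact: supportsN.
- by rewrite dotNl mum' oppr0.
Qed.

(* The reflections along [x1] and [x2] fix the same hyperplane, so their product
   is a shear; it is an isometry only if it is trivial. *)
Lemma supports_inj x1 x2 phi : supports N x1 phi -> supports N x2 phi ->
  N x1 = N x2 -> x1 = x2.
Proof.
move=> s1 s2 N12.
have [x10|x10] := eqVneq x1 0.
  by rewrite x10; apply/esym/(norm_eq0 N_norm); rewrite -N12 x10 (norm0 N_norm).
have x20 : x2 != 0.
  apply: contra_neq x10 => x20; apply: (norm_eq0 N_norm).
  by rewrite N12 x20 (norm0 N_norm).
pose d := x2 - x1.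
have phid : dot phi d = 0 by rewrite dotDr dotNr s1.2 s2.2 N12 subrr.
have refl1 l : N (x1 + l *: d) = N (x1 - l *: d).
  have := @reflection x1 phi (l *: d) 1 x10 s1.
  rewrite dotZr phid mulr0 scale1r => /(_ erefl).
  by rewrite addrC => ->; rewrite -(normN N_norm) opprB.
have refl2 l : N (x2 + l *: d) = N (x2 - l *: d).
  have := @reflection x2 phi (l *: d) 1 x20 s2.
  rewrite dotZr phid mulr0 scale1r => /(_ erefl).
  by rewrite addrC => ->; rewrite -(normN N_norm) opprB.
(* The two reflections compose to a translation by [2 *: d] on the line, so the norm would stay
   bounded along an unbounded sequence. *)
have period l : N (x1 + (l + 2) *: d) = N (x1 + l *: d).
  rewrite (_ : x1 + (l + 2) *: d = x2 + (l + 1) *: d); last first.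
    by apply/rowP => i; rewrite !mxE; ring.
  rewrite refl2 (_ : x2 - (l + 1) *: d = x1 - l *: d) -?refl1//.
  by apply/rowP => i; rewrite !mxE; ring.
have Nk (k : nat) : N (x1 + (2 * k%:R) *: d) = N x1.
  elim: k => [|k IH]; first by rewrite mulr0 scale0r addr0.
  by rewrite -[k.+1]addn1 natrD mulrDr mulr1 period.
apply/eqP; rewrite eq_sym -subr_eq0 -/d; apply/negPn/negP => d0.
have Nd := norm_gt0 N_norm d0.
pose k := (Num.truncn (N x1 / N d)).+1.
have : N x1 / N d < k%:R.
  by rewrite truncnS_gt.
rewrite ltr_pdivrMr// => kd.
have := normB_ge N_norm ((2 * k%:R) *: d) x1.
rewrite (addrC _ x1) Nk (normZ N_norm) ger0_norm ?mulr_ge0//; lra.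
Qed.

(** In [x = k + b *: a] and [y = k + (b - 1) *: a] the vector [k] is fixed by the reflection along
    [a]. Strict convexity leaves only [b = 1 / 2], and then that reflection exchanges [x] and
    [y]. *)
Lemma swap_isometry x y (p q : R) : N x = N y ->
  N (p *: x + q *: y) = N (q *: x + p *: y).
Proof.
move=> Nxy; have [<-|xy] := eqVneq x y.
  by rewrite -!scalerDl addrC.
pose a := x - y; have a0 : a != 0 by rewrite subr_eq0.
have [al sa] := supports_exists N_norm a.
have Na := norm_gt0 N_norm a0.
pose b := dot al x / N a; pose k := x - b *: a.
have alk : dot al k = 0 by rewrite dotDr dotNr dotZr sa.2 divfK ?subrr// gt_eqF.
have refl t := reflection t a0 sa alk.
have xE : x = k + b *: a by rewrite subrK.
have yE : y = k + (b - 1) *: a.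
  by rewrite scalerBl scale1r addrA -xE /a subKr.
(* The norm is even and convex in the coefficient of [a]; equal values would make it constant
   between [- c] and [c], so one functional would support both [k + c *: a] and [k - c *: a]. *)
have strict c c' : `|c'| < `|c| -> N (k + c *: a) = N (k + c' *: a) -> False.
  move=> cc' Ncc'.
  have [phi sphi] := supports_exists N_norm (k + c' *: a).
  have c0 : 0 < `|c| by apply: le_lt_trans cc'.
  have NcE : N (k - c *: a) = N (k + c *: a) by rewrite refl.
  have h1 := sphi.1 (k + c *: a); have h2 := sphi.1 (k - c *: a).
  have h3 := sphi.2.
  rewrite NcE Ncc' in h2; rewrite Ncc' in h1.
  move: h1 h2 h3; rewrite !(dotDr _ k) dotNr !dotZr.
  move=> h1 h2 h3.
  have pa : dot phi a = 0.
    apply/eqP; rewrite -normr_eq0 eq_le normr_ge0 andbT leNgt; apply/negP => A0.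
    have : `|c * dot phi a| <= `|c' * dot phi a|.
      apply: le_trans (ler_norm _); rewrite ler_norml.
      by apply/andP; split; lra.
    by rewrite !normrM ler_pM2r// leNgt cc'.
  have : k + c *: a = k - c *: a.
    apply: (@supports_inj _ _ phi) => //.
    - by split; [exact: sphi.1|rewrite Ncc' -sphi.2 !(dotDr _ k) !dotZr pa !mulr0].
    - by split; [exact: sphi.1|
        rewrite NcE Ncc' -sphi.2 !(dotDr _ k) dotNr !dotZr pa !mulr0 oppr0].
  move/addrI/eqP; rewrite -subr_eq0 opprK -scalerDl scaler_eq0 (negbTE a0) orbF.
  by rewrite -mulr2n mulrn_eq0/= -normr_eq0 gt_eqF.
have bE : b = 1 / 2.
  have [bb|bb|bb] := ltgtP `|b| `|b - 1|.
  - by case: (strict (b - 1) b bb); rewrite -xE -yE.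
  - by case: (strict b (b - 1) bb); rewrite -xE -yE.
  - move/(congr1 (fun r => r ^+ 2)): bb; rewrite !real_normK ?num_real//.
    by lra.
have := @reflection a al ((p + q) *: k) ((p - q) / 2) a0 sa.
rewrite dotZr alk mulr0 => /(_ erefl).
rewrite (_ : (p + q) *: k + _ = p *: x + q *: y); last first.
  by apply/rowP => i; rewrite /k bE /a !mxE; field.
rewrite (_ : (p + q) *: k - _ = q *: x + p *: y)//.
by apply/rowP => i; rewrite /k bE /a !mxE; field.
Qed.

Lemma orthonormal_norm x y al (p q : R) : N x = 1 -> N y = 1 ->
  supports N x al -> dot al y = 0 -> N (p *: x + q *: y) ^+ 2 = p ^+ 2 + q ^+ 2.
Proof.
move=> Nx Ny sx aly; have x0 := unit_neq0 Nx.
pose nn (a b : R) := N (a *: x + b *: y).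
have nn0 : nn 1 0 = 1 by rewrite /nn scale1r scale0r addr0.
have nnC a b : nn a b = nn b a by apply: swap_isometry; rewrite Nx Ny.
have nnN a b : nn a b = nn a (- b).
  have := @reflection x al (b *: y) a x0 sx.
  rewrite dotZr aly mulr0 => /(_ erefl).
  rewrite addrC -/(nn a b) => ->; rewrite -(normN N_norm) opprB.
  by rewrite -scaleNr.
have nnZ c a b : nn (c * a) (c * b) = `|c| * nn a b.
  by rewrite /nn -(normZ N_norm) scalerDr !scalerA.
have nnD a b a' b' : nn (a + a') (b + b') <= nn a b + nn a' b'.
  apply: le_trans (normD N_norm _ _); rewrite le_eqVlt; apply/orP; left.
  by apply/eqP; congr N; apply/rowP => i; rewrite !mxE; ring.
have circle a b : nn a b = 1 -> a ^+ 2 + b ^+ 2 = 1.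
  move=> nab; have [b0|b0] := eqVneq b 0.
    rewrite b0 in nab *; have := nnZ a 1 0; rewrite mulr1 mulr0 nab nn0 => aE.
    by have := real_normK (num_real a); rewrite -[`|a|]mulr1 -aE; lra.
  (* This entry makes the matrix in [swap] send [(a, b)] back to [(1, 0)]. *)
  pose k := (1 - a ^+ 2) / b.
  have kb : k * b = 1 - a ^+ 2 by rewrite divfK.
  have swap c d : nn c d = nn (a * c + k * d) (b * c - a * d).
    have := @swap_isometry x (a *: x + b *: y) (c - a * (d / b)) (d / b).
    rewrite Nx -/(nn a b) nab => /(_ erefl).
    rewrite (_ : _ *: x + _ = c *: x + d *: y); last first.
      by apply/rowP => i; rewrite !mxE; field.
    rewrite -/(nn c d) => ->; rewrite /nn; congr N.
    by apply/rowP => i; rewrite /k !mxE; field.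
  have rot c d : nn c d = nn (a * c - k * d) (b * c + a * d).
    by rewrite nnN swap; congr nn; ring.
  have rot' c d : nn c d = nn (a * c + b * d) (a * d - k * c).
    by rewrite nnC rot nnC; congr nn; ring.
  (* [rot'] is the transpose of [rot], so their product is a symmetric isometry of determinant one
     and trace [2 + (k - b) ^+ 2]. *)
  have inv c d : nn c d =
      nn ((a ^+ 2 + k ^+ 2) * c + a * (b - k) * d) (a * (b - k) * c + (a ^+ 2 + b ^+ 2) * d).
    by rewrite rot' rot; congr nn; ring.
  pose A1 := a ^+ 2 + k ^+ 2; pose A2 := a * (b - k); pose B1 := a ^+ 2 + b ^+ 2.
  have det : A2 * A2 + 1 = A1 * B1.
    have : A1 * B1 - A2 * A2 = (a ^+ 2 + k * b) ^+ 2 by rewrite /A1 /A2 /B1; ring.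
    by rewrite kb; lra.
  have trE : A1 + B1 = 2 + (k - b) ^+ 2 by rewrite /A1 /B1; lra.
  have tr0 : 0 <= A1 + B1 by rewrite trE; have := sqr_ge0 (k - b); lra.
  have i1 : nn A1 A2 = 1 by rewrite -nn0 [RHS]inv; congr nn; rewrite /A1 /A2; ring.
  (* By Cayley-Hamilton the square of this matrix plus the identity is its trace times itself;
     applied to [(1, 0)], the triangle inequality bounds the trace by 2. *)
  have := nnD (A1 * A1 + A2 * A2) (A2 * A1 + B1 * A2) 1 0.
  rewrite -inv nn0 i1 (_ : _ + 1 = (A1 + B1) * A1); last by lra.
  rewrite (_ : _ + 0 = (A1 + B1) * A2); last by ring.
  rewrite nnZ i1 ger0_norm// trE => le2.
  have /eqP : (k - b) ^+ 2 = 0.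
    by apply/eqP; rewrite eq_le sqr_ge0 andbT; lra.
  rewrite sqrf_eq0 subr_eq0 => /eqP kbE.
  by move: kb; rewrite kbE; lra.
rewrite -/(nn p q); have [pq0|pq0] := eqVneq (p *: x + q *: y) 0.
  have p0 : p = 0.
    by have := congr1 (dot al) pq0; rewrite dotDr !dotZr aly sx.2 Nx dot0r; lra.
  have : `|q| = 0.
    have := congr1 N pq0.
    by rewrite p0 scale0r add0r (normZ N_norm) Ny mulr1 (norm0 N_norm).
  by move=> /normr0_eq0 q0; rewrite /nn pq0 (norm0 N_norm) p0 q0 !expr0n/= addr0.
have npq : 0 < nn p q by exact: norm_gt0.
have := circle ((nn p q)^-1 * p) ((nn p q)^-1 * q).
rewrite nnZ gtr0_norm ?invr_gt0// mulVf ?gt_eqF// => /(_ erefl).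
rewrite !exprMn -mulrDr => h.
by rewrite -[RHS]mul1r -(@mulfV _ (nn p q ^+ 2)) ?expf_neq0 ?gt_eqF// -mulrA -exprVn h mulr1.
Qed.
(** A Gram-Schmidt step, with the functional supporting [e] in place of an inner product, gives an
    orthonormal pair [e], [f]. *)
Lemma plane_quadratic x y : exists c, forall s t,
  N (s *: x + t *: y) ^+ 2 =
  s ^+ 2 * N x ^+ 2 + 2 * (s * t) * c + t ^+ 2 * N y ^+ 2.
Proof.
have [->|x0] := eqVneq x 0.
  exists 0 => s t; rewrite scaler0 add0r (normZ N_norm) (norm0 N_norm) exprMn.
  by rewrite real_normK ?num_real//; ring.
have Nx := norm_gt0 N_norm x0.
pose e := (N x)^-1 *: x; have Ne : N e = 1 by exact: normalized.
have [al sal] := supports_exists N_norm e.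
pose b := dot al y; pose k := y - b *: e.
have alk : dot al k = 0 by rewrite dotDr dotNr dotZr sal.2 Ne mulr1 subrr.
have [f [r [Nf alf kE]]] : exists f r, [/\ N f = 1, dot al f = 0 & k = r *: f].
  have [k0|k0] := eqVneq k 0.
    have [w w0 [alw _]] := exists_orthogonal2 n3 al al.
    exists ((N w)^-1 *: w), 0; split; [exact: normalized| |by rewrite scale0r].
    by rewrite dotZr alw mulr0.
  exists ((N k)^-1 *: k), (N k); split; [exact: normalized| |].
    by rewrite dotZr alk mulr0.
  by rewrite scalerA divff ?scale1r// gt_eqF// norm_gt0.
have yE : y = b *: e + r *: f by rewrite -kE subrKC.
have xE : x = N x *: e by rewrite scalerA divff ?scale1r// gt_eqF.
have sq := orthonormal_norm _ _ Ne Nf sal alf.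
exists (N x * b) => s t; rewrite [in N y]yE sq.
rewrite (_ : _ + t *: y = (s * N x + t * b) *: e + (t * r) *: f) ?sq; first by ring.
by rewrite scalerDl -!scalerA -xE -addrA -scalerDr -yE.
Qed.

End Reflections.

(** * Transporting the projection to coordinates *)

Lemma opnorm1_le (R : realType) (X : normedModType R) (P : {linear X -> X}) :
  opnorm P = 1 -> forall x, `|P x| <= `|x|.
Proof.
move=> P1 x; pose S := [set `|P x| | x in [set x : X | `|x| <= 1]].
(* Without a supremum [sup] would take its default value 0, not 1. *)
have supS : has_sup S.
  apply: contrapT => /sup_out; rewrite -/(opnorm P) P1 => /eqP.
  by rewrite oner_eq0.
have [->|x0] := eqVneq x 0; first by rewrite linear0.
have nx : 0 < `|x| by rewrite normr_gt0.
have : S `|P (`|x|^-1 *: x)|.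
  exists (`|x|^-1 *: x) => //=.
  by rewrite normrZ normfV normr_id mulVf// gt_eqF.
move/(sup_upper_bound supS); rewrite -/(opnorm P) P1 linearZ normrZ normfV normr_id.
by rewrite mulrC ler_pdivrMr// mul1r.
Qed.

Section Coordinates.
Variables (R : realType) (X : normedModType R) (n : nat) (b : 'I_n -> X).
Implicit Types v w : 'rV[R]_n.

Definition comb v : X := \sum_(i < n) v 0 i *: b i.

Lemma combD v w : comb (v + w) = comb v + comb w.
Proof.
by rewrite /comb -big_split; apply: eq_bigr => i _; rewrite mxE scalerDl.
Qed.

Lemma combZ (a : R) v : comb (a *: v) = a *: comb v.
Proof.
by rewrite /comb scaler_sumr; apply: eq_bigr => i _; rewrite mxE scalerA.
Qed.

Lemma comb_delta i : comb (delta_mx 0 i) = b i.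
Proof.
rewrite /comb (bigD1 i)//= mxE !eqxx scale1r big1 ?addr0// => j ji.
by rewrite mxE (negbTE ji) scale0r.
Qed.

Hypothesis b_free : forall v, comb v = 0 -> v = 0.

Lemma comb_norm : is_norm (fun v => `|comb v|).
Proof.
split => [v w|a v|v /eqP]; first by rewrite combD ler_normD.
  by rewrite combZ normrZ.
by rewrite normr_eq0 => /eqP /b_free.
Qed.

Variables (P : {linear X -> X}) (u : X).
Hypothesis P_le : forall x, `|P x| <= `|x|.
Hypothesis u_unit : `|u| = 1.
Hypothesis Pu : P u = 0.
Hypothesis P_rank : forall x, exists t : R, x - P x = t *: u.

(** Conjugating [P] by [T] gives a projection with kernel spanned by [T u]; [dot g w] is the
    coefficient of [u] in the preimage of [comb w]. It is at most [2 * |comb w|] in absolute value,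
    so replacing [T u] by [y] costs at most [e] times that. *)
Lemma coord_functional (T : {linear X -> X}) y v (r e : R) :
  is_surj_lin_isometry T -> comb v = r *: y -> 0 <= r -> `|T u - y| <= e ->
  exists g : 'rV[R]_n, [/\ forall i, `|g 0 i| <= 2 * \sum_(i < n) `|b i|,
    forall w, `|comb w - dot g w *: y| <= `|comb w| + e * (2 * `|comb w|)
  & `|dot g v - r| <= e * (2 * r)].
Proof.
move=> [Tiso Tsurj] vE r0 Tu.
have P2 x (t : R) : x - P x = t *: u -> `|t| <= 2 * `|x|.
  move=> /(congr1 Num.norm); rewrite normrZ u_unit mulr1 => <-.
  by apply: le_trans (ler_normB _ _) _; have := P_le x; lra.
have /choice[a aP] i : exists x, T x = b i by exact: Tsurj.
have /choice[g0 gP] i : exists t : R, a i - P (a i) = t *: u by exact: P_rank.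
pose g : 'rV[R]_n := \row_i g0 i.
pose p w := \sum_(i < n) w 0 i *: a i.
have Tp w : T (p w) = comb w.
  by rewrite linear_sum; apply: eq_bigr => i _; rewrite linearZ/= aP.
have gp w : p w - P (p w) = dot g w *: u.
  rewrite linear_sum -sumrB scaler_suml; apply: eq_bigr => i _.
  by rewrite linearZ/= -scalerBr gP scalerA mxE mulrC.
have np w : `|p w| = `|comb w| by rewrite -Tp Tiso.
exists g; split.
- move=> i; rewrite mxE; apply: le_trans (P2 _ _ (gP i)) _.
  rewrite -Tiso aP ler_pM2l// (bigD1 i)//= lerDl.
  by apply: sumr_ge0 => j _.
- move=> w.
  have -> : comb w - dot g w *: y = T (P (p w)) + dot g w *: (T u - y).
    have -> : P (p w) = p w - dot g w *: u by rewrite -gp subKr.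
    by rewrite linearB [T (_ *: u)]linearZ/= Tp scalerBr addrA subrK.
  apply: le_trans (ler_normD _ _) _; rewrite Tiso normrZ; apply: lerD.
    by rewrite -np; exact: P_le.
  by rewrite mulrC -np; apply: ler_pM => //; exact: P2 (gp w).
- have -> : `|dot g v - r| = `|(p v - r *: u) - P (p v - r *: u)|.
    rewrite linearB [P (_ *: u)]linearZ/= Pu scaler0 subr0 addrAC gp -scalerBl normrZ.
    by rewrite u_unit mulr1.
  apply: le_trans (ler_normB _ _) _.
  have : `|p v - r *: u| <= r * e.
    rewrite -Tiso linearB [T (_ *: u)]linearZ/= Tp vE -scalerBr normrZ ger0_norm//.
    by rewrite distrC ler_wpM2l.
  by have := P_le (p v - r *: u); lra.
Qed.

Hypothesis X_trans : almost_transitive X.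

(** Almost transitivity brings [u] arbitrarily close to the direction of [comb v]; the functionals
    so obtained converge by compactness, and dividing by [r] normalizes the limit. *)
Lemma coord_proj v : v != 0 -> exists2 g : 'rV[R]_n, dot g v = 1 &
  forall w, `|comb (w - dot g w *: v)| <= `|comb w|.
Proof.
move=> v0; pose r := `|comb v|; have r0 : 0 < r.
  by rewrite normr_gt0; apply: contra v0 => /eqP/b_free ->.
pose y := r^-1 *: comb v.
have vE : comb v = r *: y by rewrite scalerA divff ?scale1r// gt_eqF.
have ny : `|y| = 1 by rewrite normrZ gtr0_norm ?invr_gt0// mulVf// gt_eqF.
pose Q (e : R) (g : 'rV[R]_n) :=
  (forall w, `|comb w - dot g w *: y| <= `|comb w| + e * (2 * `|comb w|)) /\
  `|dot g v - r| <= e * (2 * r).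
have [||g gQ] := @row_compactness R n (2 * \sum_(i < n) `|b i|) Q.
- move=> e e' g ee' [h1 h2]; split => [w|].
    by apply: le_trans (h1 w) _; rewrite lerD2l ler_wpM2r// mulr_ge0.
  by apply: le_trans h2 _; rewrite ler_wpM2r// mulr_ge0// ltW.
- move=> e e0; have [T [Tiso Tu]] := X_trans u_unit ny e0.
  by have [g [? ? ?]] := coord_functional Tiso vE (ltW r0) (ltW Tu); exists g.
have gv : dot g v = r.
  apply/eqP; rewrite -subr_eq0 -normr_le0.
  apply: (@ger_of_small _ _ _ (\sum_(i < n) `|v 0 i| + 2 * r)) => e /gQ[g'].
  move=> /(dot_dist_bound v) h1 [_ h2]; rewrite add0r mulrDr.
  have := ler_normB (dot g' v - r) (dot g' v - dot g v).
  by rewrite opprB addrC addrA subrK; lra.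
exists (r^-1 *: g); first by rewrite dotZl gv mulVf// gt_eqF.
move=> w; rewrite combD -scaleN1r !combZ vE scaleN1r dotZl scalerA.
rewrite mulrAC mulVf ?gt_eqF// mul1r.
apply: (@ger_of_small _ _ _ (2 * `|comb w| + \sum_(i < n) `|w 0 i|)) => e.
move=> /gQ[g' /(dot_dist_bound w) h1 [/(_ w) h2 _]].
have -> : comb w - dot g w *: y =
    (comb w - dot g' w *: y) + (dot g' w - dot g w) *: y.
  by rewrite scalerBl addrA subrK.
apply: le_trans (ler_normD _ _) _; rewrite normrZ ny mulr1.
by lra.
Qed.

End Coordinates.

(** * The inner product obtained by polarization *)

Section JordanVonNeumann.
Variables (R : realType) (X : normedModType R).
Hypothesis plane : forall x y : X, exists c, forall s t : R,
  `|s *: x + t *: y| ^+ 2 =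
  s ^+ 2 * `|x| ^+ 2 + 2 * (s * t) * c + t ^+ 2 * `|y| ^+ 2.

Definition polar (x y : X) : R := (`|x + y| ^+ 2 - `|x| ^+ 2 - `|y| ^+ 2) / 2.

Lemma parallelogram (x y : X) :
  `|x + y| ^+ 2 + `|x - y| ^+ 2 = 2 * `|x| ^+ 2 + 2 * `|y| ^+ 2.
Proof.
have [c cP] := plane x y; have := cP 1 1; have := cP 1 (-1).
by rewrite !scale1r scaleN1r => -> ->; ring.
Qed.

Lemma polarZ (a : R) x y : polar (a *: x) y = a * polar x y.
Proof.
have [c cP] := plane x y; have := cP 1 1; have := cP a 1; have := cP a 0.
rewrite /polar !scale1r scale0r addr0 => -> -> ->.
by field.
Qed.

Lemma polarD x x' y : polar (x + x') y = polar x y + polar x' y.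
Proof.
have := parallelogram (x + y) x'; have := parallelogram x (y - x').
have := parallelogram (x + x') y; have := parallelogram y x'.
rewrite /polar opprB !addrA (addrAC x y x') (addrAC x y (- x')).
rewrite (addrAC x (- x') y) (addrAC x x' (- y)).
by rewrite -[x' + y]addrC; lra.
Qed.

Lemma polar_inner_product : inner_product_for_norm polar.
Proof.
have polarxx x : polar x x = `|x| ^+ 2.
  by rewrite /polar -mulr2n -scaler_nat normrZ exprMn normr_nat; field.
split => [x y|a x y z|x|x|x] //.
- by rewrite /polar (addrC x y); field.
- by rewrite polarD polarZ.
- by rewrite polarxx sqr_ge0.
- by rewrite polarxx => /eqP; rewrite sqrf_eq0 normr_eq0 => /eqP.
Qed.

End JordanVonNeumann.

(** * Three-dimensional subspaces and the conclusion *)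

Lemma dim_ge3_extend (R : realType) (X : normedModType R) (x y : X) :
  dim_ge3 X -> exists z, forall a b : R, z <> a *: x + b *: y.
Proof.
move=> [x1 [x2 [x3 free]]]; apply: contrapT => nex.
have span z : exists ab : R * R, z = ab.1 *: x + ab.2 *: y.
  apply: contrapT => nz; apply: nex; exists z => a b zE.
  by apply: nz; exists (a, b).
have [[a1 b1] /= e1] := span x1; have [[a2 b2] /= e2] := span x2.
have [[a3 b3] /= e3] := span x3.
pose a : 'rV[R]_3 := \row_i nth 0 [:: a1; a2; a3] i.
pose b : 'rV[R]_3 := \row_i nth 0 [:: b1; b2; b3] i.
have [w w0 []] := exists_orthogonal2 (isT : (2 < 3)%N) a b.
rewrite /dot !big_ord_recr !big_ord0 !mxE/= !add0r.
set w1 := w 0 _; set w2 := w 0 _; set w3 := w 0 _ => aw bw.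
have [|h1 h2 h3] := free w1 w2 w3.
  rewrite e1 e2 e3 !scalerDr !scalerA.
  rewrite (_ : _ + _ = (a1 * w1 + a2 * w2 + a3 * w3) *: x +
    (b1 * w1 + b2 * w2 + b3 * w3) *: y); first by rewrite aw bw !scale0r addr0.
  rewrite !scalerDl !(mulrC _ w1) !(mulrC _ w2) !(mulrC _ w3).
  by rewrite (addrACA ((w1 * a1) *: x)) [LHS]addrACA.
move/eqP: w0; apply; apply/rowP => -[[|[|[|i]]] hi]//; rewrite mxE.
- by rewrite -h1; congr (w _ _); exact/val_inj.
- by rewrite -h2; congr (w _ _); exact/val_inj.
- by rewrite -h3; congr (w _ _); exact/val_inj.
Qed.

Lemma rank1_complement (R : realType) (X : normedModType R) (P : {linear X -> X}) :
  (forall x, P (P x) = P x) -> closed_codim1 (range P) ->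
  exists u, [/\ `|u| = 1, P u = 0 & forall x, exists t : R, x - P x = t *: u].
Proof.
move=> PP [_ [v [Pv vP]]].
have u0 : v - P v != 0.
  by rewrite subr_eq0; apply/eqP => vE; apply: Pv; exists v.
have nu : 0 < `|v - P v| by rewrite normr_gt0.
exists (`|v - P v|^-1 *: (v - P v)); split.
- by rewrite normrZ gtr0_norm ?invr_gt0// mulVf// gt_eqF.
- by rewrite linearZ/= linearB PP subrr scaler0.
- move=> x; have [m [t [[z _ <-] ->]]] := vP x.
  exists (t * `|v - P v|); rewrite scalerA mulfK ?gt_eqF//.
  by rewrite linearD linearZ/= PP opprD addrACA subrr add0r scalerBr.
Qed.

Theorem theorem2p7 (R : realType) (X : completeNormedModType R) :
  dim_ge3 X ->
  (exists P : {linear X -> X},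
      (forall x, P (P x) = P x) /\ opnorm P = 1 /\ closed_codim1 (range P)) ->
  almost_transitive X ->
  isometric_to_Hilbert X.
Proof.
move=> dim3 [P [PP [P1 codimP]]] trans.
have [u [u1 Pu Prank]] := rank1_complement PP codimP.
(* Completeness is given, so [X] itself with the polar form is the Hilbert space. *)
exists X, (@polar R X), idfun; split; last by split => // y; exists y.
apply: polar_inner_product => x y.
have [->|x0] := eqVneq x 0.
  exists 0 => s t; rewrite scaler0 add0r normrZ normr0 exprMn.
  by rewrite real_normK ?num_real//; ring.
have [[a ->]|yx] := pselect (exists a : R, y = a *: x).
  exists (a * `|x| ^+ 2) => s t; rewrite scalerA -scalerDl !normrZ !exprMn.
  by rewrite !real_normK ?num_real//; ring.
(* Independent [x] and [y] are completed to a basis of a three-dimensional subspace, where the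
   results on rows apply. *)
have [z zP] := dim_ge3_extend x y dim3.
pose b (i : 'I_3) : X := nth 0 [:: x; y; z] i.
have combE v : comb b v = v 0 0 *: x + v 0 1 *: y + v 0 2%:R *: z.
  rewrite /comb !big_ord_recr big_ord0 /= add0r.
  by congr (v _ _ *: _ + v _ _ *: _ + v _ _ *: _); exact/val_inj.
have b_free v : comb b v = 0 -> v = 0.
  rewrite combE => v0.
  have v2 : v 0 2%:R = 0.
    apply: contrapT => /eqP v2.
    apply: (zP (- (v 0 0 / v 0 2%:R)) (- (v 0 1 / v 0 2%:R))).
    apply: (scalerI v2); move/eqP: v0; rewrite addrC addr_eq0 => /eqP ->.
    rewrite opprD scalerDr !scalerA !mulrN !(mulrC (v 0 2%:R)) !divfK//.
    by rewrite !scaleNr.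
  move: v0; rewrite v2 scale0r addr0 => v0.
  have v1 : v 0 1 = 0.
    apply: contrapT => /eqP v1; apply: yx; exists (- (v 0 0 / v 0 1)).
    apply: (scalerI v1); move/eqP: v0; rewrite addrC addr_eq0 => /eqP ->.
    by rewrite scalerA mulrN mulrC divfK// scaleNr.
  move/eqP: v0; rewrite v1 scale0r addr0 scaler_eq0 (negbTE x0) orbF => /eqP v00.
  apply/rowP => -[[|[|[|i]]] hi]//; rewrite mxE.
  - by rewrite -v00; congr (v _ _); exact/val_inj.
  - by rewrite -v1; congr (v _ _); exact/val_inj.
  - by rewrite -v2; congr (v _ _); exact/val_inj.
have proj := coord_proj b_free (opnorm1_le P1) u1 Pu Prank trans.
have [c cP] := plane_quadratic (comb_norm b_free) proj (isT : (2 < 3)%N)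
  (delta_mx 0 0) (delta_mx 0 1).
by exists c => s t; have := cP s t; rewrite combD !combZ !comb_delta.
Qed.
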